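(* Let $G=(V,E,W)$ be a finite weighted, undirected, connected graph with positive edge weights, and suppose that $C=(K,L)$ is a maximum minimal cut of $G$ with cut value $\psi$. Then $C$ can be obtained by disconnecting an edge of a certain spanning tree of $G$: there exist a spanning tree $T=(V_T,E_T)$ of $G$ and an edge $e\in E_T$ such that the two connected components of $T$ with $e$ removed have vertex sets equal to the vertex set of $K$ and the vertex set of $L$, respectively.
   Context: Let $G=(V,E,W)$ be a finite undirected connected graph with edge weights in $\mathbb{R}^{+}$ (positive reals). A minimal cut of $G$ is a pair $C=(K,L)$ of disjoint connected subgraphs $K=(V_1,E_1)$, $L=(V_2,E_2)$ of $G$ with $V_1\cup V_2=V$, $V_1\cap V_2=\emptyset$, such that $E$ is the disjoint union of $E_1$, $E_2$ and the set $F$ of edges of $G$ joining $V_1$ to $V_2$, and $F$ is nonempty (so $V_1,V_2$ are nonempty, and $K,L$ are the subgraphs of $G$ induced by $V_1,V_2$). The set $F$ is the cut-set of $C$ and the cut value of $C$ is the sum of the weights of the edges in $F$. A maximum minimal cut is a minimal cut with the largest cut value among all minimal cuts of $G$. *)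

(* Defs.v *)
From mathcomp Require Import all_boot all_order all_algebra.
From mathcomp Require Import reals.
Set Implicit Arguments.
Unset Strict Implicit.
Unset Printing Implicit Defensive.

Import Order.TTheory GRing.Theory Num.Theory.
Local Open Scope ring_scope.

(* A finite simple graph whose vertices are taken in an ambient finite type V.
   An edge is the two-element set of its endpoints, so that a graph, its
   subgraphs and its spanning trees all have the same type. *)
Record graph (V : finType) := Graph {
  vset : {set V};
  eset : {set {set V}};
  esetP : forall f, f \in eset -> (f \subset vset) && (#|f| == 2)%N
}.

Section Graph.
Variable V : finType.
Implicit Types (G H K L T : graph V) (f : {set V}).

Definition adj H : rel V := [rel x y | [set x; y] \in eset H].

Definition connected H : Prop :=
  vset H != set0 /\ {in vset H &, forall x y, connect (adj H) x y}.

(* Vertex sets of the connected components. *)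
Definition components H : {set {set V}} :=
  equivalence_partition (connect (adj H)) (vset H).

(* Duplicate-free cyclic sequences of length 2 merely traverse one edge back
   and forth, hence the bound. *)
Definition acyclic H : Prop := forall c, ucycle (adj H) c -> (size c < 3)%N.

Definition subgraph H G : Prop := vset H \subset vset G /\ eset H \subset eset G.

Definition spanning_tree T G : Prop :=
  [/\ subgraph T G, vset T = vset G, connected T & acyclic T].

Lemma remove_edge_proof H f g :
  g \in eset H :\ f -> (g \subset vset H) && (#|g| == 2)%N.
Proof. by move/setD1P=> [_ /esetP]. Qed.

Definition remove_edge H f : graph V := Graph (@remove_edge_proof H f).

Definition cut_set G K L : {set {set V}} :=
  [set f in eset G |
    [exists x in vset K, [exists y in vset L, f == [set x; y]]]].

Definition min_cut G K L : Prop :=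
  [/\ (subgraph K G /\ connected K),
      (subgraph L G /\ connected L),
      (vset K :|: vset L = vset G /\ vset K :&: vset L = set0),
      [/\ eset G = eset K :|: eset L :|: cut_set G K L,
          [disjoint eset K & eset L],
          [disjoint eset K & cut_set G K L] &
          [disjoint eset L & cut_set G K L]]
    & cut_set G K L != set0].

Definition cut_value (R : realType) (W : {set V} -> R) G K L : R :=
  \sum_(f in cut_set G K L) W f.

Definition max_min_cut (R : realType) (W : {set V} -> R) G K L : Prop :=
  min_cut G K L /\
  forall K' L', min_cut G K' L' -> cut_value W G K' L' <= cut_value W G K L.

End Graph.

(* Main.v *)
(* Join K and L by a single edge f of the cut-set and take any spanning tree T
   of the resulting connected graph.  Since f is the only edge between the two
   sides, T uses it.  Removing f from T leaves each side connected: a vertex of K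
   that is not linked to the endpoint of f in K without using f could not be
   linked to it in T at all. *)
Require Import Defs.
From mathcomp Require Import all_boot all_order all_algebra.
From mathcomp Require Import reals.
Set Implicit Arguments.
Unset Strict Implicit.
Unset Printing Implicit Defensive.
Import Order.TTheory GRing.Theory Num.Theory.
Local Open Scope ring_scope.

Section SpanningTree.
Variable V : finType.
Implicit Types (G H T : graph V) (f A : {set V}).

Lemma connect_adjC H : connect_sym (adj H).
Proof. by apply: sym_connect_sym => x y; rewrite /adj /= setUC. Qed.

Lemma adj_remove_edge H f x y :
  adj (remove_edge H f) x y = ([set x; y] != f) && adj H x y.
Proof. by rewrite /adj /= in_setD1. Qed.

(** The rest of the cycle is a detour from [y] back to [x] avoiding the edge between them. With [p]
    empty it would be that same edge traversed backwards. *)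
Lemma connected_remove_cycle_edge H x y p :
    connected H -> ucycle (adj H) [:: x, y & p] -> p != [::] ->
  connected (remove_edge H [set x; y]).
Proof.
move=> [H0 Hc] /andP[/=]; rewrite rcons_path => /and3P[_ Hp Hl].
case/and3P=> xNyp yNp _ pN0; split=> // a b aH bH.
set e' := adj _.
have yx : connect e' y x.
  apply: (@connect_trans _ _ (last y p)).
    (* The path along [p] never visits [x], so none of its edges is the removed one. *)
    apply/connectP; exists p => //.
    apply: (@sub_in_path _ (predC1 x) (adj H)) Hp.
      move=> c d /= cNx dNx cd; rewrite /e' adj_remove_edge cd andbT.
      apply: contraTneq (set21 x y) => <-.
      by rewrite in_set2 !(eq_sym x) negb_or; apply/andP.
    apply/allP=> z zyp; apply: contraNneq xNyp.
    by move=> /= <-.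
  (* The closing edge from [last y p] to [x] misses [y], because [p] is nonempty and does not
     contain [y]. *)
  apply: connect1; rewrite /e' adj_remove_edge Hl andbT eq_sym.
  apply: contraTneq (set22 x y) => ->; rewrite in_set2 negb_or.
  apply/andP; split.
    apply: contraNneq yNp => {1}->.
    by case: (p) pN0 => // z q _; rewrite /= mem_last.
  by apply: contraNneq xNyp => <-; rewrite mem_head.
apply: connect_sub (Hc a b aH bH) => c d cd.
have [E|ne] := eqVneq [set c; d] [set x; y]; last first.
  by apply: connect1; rewrite /e' adj_remove_edge ne.
have := set21 c d; have := set22 c d; rewrite E !in_set2.
have xy : connect e' x y by rewrite connect_adjC.
by case/orP=> /eqP-> /orP[] /eqP->.
Qed.

(** Induction on a bound for the number of edges: while some edge can be deleted without losing
    connectedness, delete it. Once there is none, the graph has no cycle, since any edge of a cycle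
    could be deleted. *)
Lemma ex_spanning_tree G : connected G -> exists T, spanning_tree T G.
Proof.
move: {2}#|eset G| (leqnn #|eset G|) => n.
elim: n G => [|n IHn] G leGn Gc.
all: pose P f := [forall x in vset G, forall y in vset G,
                    connect (adj (remove_edge G f)) x y].
all: have [/exists_inP[f fG /forall_inP Pf]|/exists_inP noP] :=
  boolP [exists f in eset G, P f].
1,3: move: leGn; rewrite (cardsD1 f) fG // add1n ltnS => leGn.
  case: (IHn (remove_edge G f)) => // [|T [[TV TE] VT Tc Ta]].
    by split=> [|x y xG yG]; [case: Gc | move/forall_inP: (Pf x xG); apply].
  exists T; split=> //; split=> //.
  exact: subset_trans TE (subsetDl _ _).
(* The tree is [G] itself; only cycles with at least three vertices remain to be excluded, and their
   first edge would be removable. *)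
all: exists G; split=> // -[|x [|y [|z p]]] // xyp.
all: case: noP; exists [set x; y].
1,3: by case/andP: xyp => /andP[].
all: have [_ Hc] := connected_remove_cycle_edge Gc xyp isT.
all: by apply/forall_inP=> a aG; apply/forall_inP=> b bG; apply: Hc.
Qed.

(** In [T], only [f] can leave [A], and only through [u]. As [T] is connected, each vertex of [A]
    must therefore reach [u] without using [f]. *)
Lemma remove_edge_component T f A u x :
    connected T -> A \subset vset T -> f :&: A = [set u] ->
    closed (adj (remove_edge T f)) (mem A) -> x \in A ->
  [set y in vset T | connect (adj (remove_edge T f)) x y] = A.
Proof.
move=> [_ Tc] /subsetP sAT fA clA; set e' := adj _.
have /setIP[_ uA] : u \in f :&: A by rewrite fA set11.
have to_u y : y \in A -> connect e' y u.
  move=> yA; apply: contraT => Nyu.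
  (* If [y] did not reach [u], its reachable set would be closed even in [T]: restoring [f] could
     extend it only from a vertex of [f] in [A], that is, from [u]. *)
  have clC : closed (adj T) [pred z | connect e' y z].
    apply: (intro_closed (@connect_adjC T)) => a b ab /= ya.
    apply: (connect_trans ya); apply: connect1.
    rewrite /e' adj_remove_edge ab andbT; apply: contra Nyu => /eqP fE.
    suff /set1P<- : a \in [set u] by [].
    rewrite -fA inE -fE set21 /=.
    by have := closed_connect clA ya; rewrite /= yA => <-.
  have := closed_connect clC (Tc y u (sAT y yA) (sAT u uA)).
  by rewrite !inE connect0 (negPf Nyu).
move=> xA; apply/setP=> y; rewrite inE; apply/andP/idP=> [[_ xy]|yA].
  by have := closed_connect clA xy; rewrite /= xA => <-.
split; first exact: sAT.
by apply: connect_trans (to_u x xA) _; rewrite connect_adjC to_u.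
Qed.

End SpanningTree.

Theorem theorem4 (R : realType) (V : finType) (G : graph V)
    (W : {set V} -> R) (K L : graph V) (psi : R)
    (G_connected : connected G)
    (W_gt0 : forall f, f \in eset G -> 0 < W f)
    (KL_max : max_min_cut W G K L)
    (KL_value : cut_value W G K L = psi) :
  exists (T : graph V) (f : {set V}),
    [/\ spanning_tree T G,
        f \in eset T
      & components (remove_edge T f) = [set vset K; vset L]].
Proof.
case: KL_max => -[[[sKG _] [_ Kc]] [[sLG _] [_ Lc]] [KL_cover KL_disj] [GE _ _ _]].
move=> /set0Pn[f fcut] _.
have fG : f \in eset G by move: fcut; rewrite inE => /andP[].
have [u uK [v vL fE]] : exists2 u, u \in vset K & exists2 v, v \in vset L & f = [set u; v].
  move: fcut; rewrite inE => /andP[_ /exists_inP[u uK /exists_inP[v vL /eqP->]]].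
  by exists u => //; exists v.
have NKL x : x \in vset K -> x \in vset L -> False.
  by move=> xK xL; have := in_set0 x; rewrite -KL_disj inE xK xL.
pose E := f |: (eset K :|: eset L).
have sEG : E \subset eset G by rewrite subUset sub1set fG GE subsetUl.
have EP g : g \in E -> (g \subset vset G) && (#|g| == 2)%N.
  by move/(subsetP sEG)/esetP.
pose H := Graph EP.
have inH g : (g \in eset H) = [|| g == f, g \in eset K | g \in eset L].
  by rewrite !inE.
have Hc : connected H.
  have subK : {in vset K &, forall x y, connect (adj H) x y}.
    move=> x y xK yK; apply: connect_sub (Kc x y xK yK) => a b ab.
    by apply: connect1; rewrite /adj [_ a b]inH [_ \in eset K]ab orbT.
  have subL : {in vset L &, forall x y, connect (adj H) x y}.
    move=> x y xL yL; apply: connect_sub (Lc x y xL yL) => a b ab.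
    by apply: connect1; rewrite /adj [_ a b]inH [_ \in eset L]ab !orbT.
  have uv : connect (adj H) u v by apply: connect1; rewrite /adj [_ u v]inH -fE eqxx.
  (* A vertex of [L] first goes to [v] inside [L], then crosses [f]. *)
  have to_u x : x \in vset H -> connect (adj H) x u.
    rewrite /= -KL_cover => /setUP[xK|xL]; first exact: subK.
    by apply: connect_trans (subL x v xL vL) _; rewrite connect_adjC.
  split=> [|x y xH yH]; first by case: G_connected.
  by apply: connect_trans (to_u x xH) _; rewrite connect_adjC to_u.
have [T [[_ sTH] VT Tc Ta]] := ex_spanning_tree Hc.
have [_ TC] := Tc.
have sides a b : adj (remove_edge T f) a b ->
    (a \in vset K) && (b \in vset K) || (a \in vset L) && (b \in vset L).
  rewrite adj_remove_edge => /andP[/negPf abNf /(subsetP sTH)].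
  rewrite inH abNf /= => /orP[] /esetP/andP[/subsetP sab _].
    by rewrite !sab ?set21 ?set22.
  by rewrite !sab ?set21 ?set22 ?orbT.
have clK : closed (adj (remove_edge T f)) (mem (vset K)).
  apply: (intro_closed (@connect_adjC _ _)) => a b /sides /orP[/andP[]|/andP[aL _]] //.
  by move=> aK; case: (NKL a).
have clL : closed (adj (remove_edge T f)) (mem (vset L)).
  apply: (intro_closed (@connect_adjC _ _)) => a b /sides /orP[/andP[aK _]|/andP[]] //.
  by move=> aL; case: (NKL a).
have VTE : vset T = vset K :|: vset L by rewrite VT KL_cover.
have sKT : vset K \subset vset T by rewrite VTE subsetUl.
have sLT : vset L \subset vset T by rewrite VTE subsetUr.
(* Otherwise deleting [f] changes nothing, and [vset K] is closed in the connected [T] although it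
   contains [u] and not [v]. *)
have fT : f \in eset T.
  apply: contraT => fNT.
  have clT : closed (adj T) (mem (vset K)).
    move=> a b ab; apply: clK; rewrite adj_remove_edge ab andbT.
    by apply: contraNneq fNT => <-.
  have := closed_connect clT (TC u v (subsetP sKT u uK) (subsetP sLT v vL)).
  by rewrite /= uK => /esym /NKL[].
have fK : f :&: vset K = [set u].
  apply/setP=> z; rewrite fE !inE; apply/andP/eqP=> [[/orP[]/eqP->//]|->].
    by move/NKL => /(_ vL).
  by rewrite eqxx.
have fL : f :&: vset L = [set v].
  apply/setP=> z; rewrite fE !inE; apply/andP/eqP=> [[/orP[]/eqP->//]|->].
    by move/(NKL _ uK).
  by rewrite eqxx orbT.
(* [H] has all the vertices of [G], so a spanning tree of [H] also spans [G]. *)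
exists T, f; split=> //.
  split=> //; split; first by rewrite VT.
  exact: subset_trans sTH sEG.
have compK := remove_edge_component Tc sKT fK clK.
have compL := remove_edge_component Tc sLT fL clL.
(* Each vertex lies on one side and its class is that whole side; conversely [u] and [v] show that
   both sides occur as classes. *)
apply/setP=> D; rewrite in_set2; apply/imsetP/orP.
  case=> x; rewrite [_ \in _]/(x \in vset T) VTE => /setUP[xK|xL] ->.
    by left; rewrite compK.
  by right; rewrite compL.
case=> /eqP->; [exists u; rewrite ?compK | exists v; rewrite ?compL] => //.
  exact: (subsetP sKT).
exact: (subsetP sLT).
Qed.
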